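(* Let $0<\epsilon,\delta,\lambda<1$, $F=1-\epsilon$, $\nu=1-\lambda$, $k_+=\lceil\log_\lambda\delta\rceil$, $k_-=\lfloor\log_\lambda\delta\rfloor$. Then $$k_-+\Big\lceil\frac{k_-F}{\lambda\epsilon}\Big\rceil\le N(\epsilon,\delta,\lambda)\le k_++\Big\lceil\frac{k_+F}{\lambda\epsilon}\Big\rceil,$$ $$N(\epsilon,\delta,\lambda)\le\Big\lceil\frac{\log_\lambda\delta}{\lambda\epsilon}-\frac{\nu k_-}{\lambda}\Big\rceil=\Big\lceil\frac{\ln\delta}{\lambda\epsilon\ln\lambda}-\frac{\nu k_-}{\lambda}\Big\rceil.$$ All three bounds are saturated when $\log_\lambda\delta$ is an integer.
   Context: Let $\mathcal H$ be a Hilbert space of finite dimension $D\ge 2$ and $|\Psi\rangle\in\mathcal H$ a unit vector. For $0\le\lambda<1$ let $\Omega_\lambda=|\Psi\rangle\langle\Psi|+\lambda(1-|\Psi\rangle\langle\Psi|)$. For an integer $N\ge1$ and a density operator $\rho$ on $\mathcal H^{\otimes(N+1)}$ put $p_\rho=\mathrm{tr}[(\Omega_\lambda^{\otimes N}\otimes 1)\rho]$ and $f_\rho=\mathrm{tr}[(\Omega_\lambda^{\otimes N}\otimes|\Psi\rangle\langle\Psi|)\rho]$. Define $F(N,\delta,\lambda)=\min\{f_\rho/p_\rho: p_\rho\ge\delta\}$ for $0<\delta\le1$, the minimum over permutation-invariant density operators on $\mathcal H^{\otimes(N+1)}$, and for $0<\epsilon,\delta<1$ let $N(\epsilon,\delta,\lambda)=\min\{N\ge1: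 F(N,\delta,\lambda)\ge1-\epsilon\}$. *)

(* Defs.v *)
From HB Require Import structures.
From mathcomp Require Import all_boot all_order all_algebra.
From mathcomp Require Import complex fingroup perm.
From mathcomp Require Import all_classical all_reals all_analysis.
Set Implicit Arguments. Unset Strict Implicit. Unset Printing Implicit Defensive.
Import Order.TTheory GRing.Theory Num.Theory.
Local Open Scope ring_scope.
Local Open Scope classical_set_scope.

Section QDefs.
Variable R : realType.
Local Notation C := (R[i]).

(* Operators on a finite-dimensional Hilbert space with orthonormal basis indexed
   by a finite type T: matrices T -> T -> C. *)
Definition op (T : finType) := T -> T -> C.

Definition trace (T : finType) (A : op T) : C := \sum_(i : T) A i i.

Definition mulop (T : finType) (A B : op T) : op T :=
  fun i j => \sum_(k : T) A i k * B k j.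

Definition psd (T : finType) (A : op T) : Prop :=
  forall v : T -> C, 0 <= \sum_(i : T) \sum_(j : T) (v i)^* * A i j * v j.

Definition density (T : finType) (rho : op T) : Prop :=
  psd rho /\ trace rho = 1.

(* H = C^D with basis 'I_D; H^{(x)(N+1)} has basis {ffun 'I_N.+1 -> 'I_D}. *)
Definition tens_idx (D N : nat) := {ffun 'I_N.+1 -> 'I_D}.

Definition tensor (D N : nat) (A : 'I_N.+1 -> op 'I_D) : op (tens_idx D N) :=
  fun s t => \prod_(k < N.+1) A k (s k) (t k).

(* permutation invariance:  P_sigma rho P_sigma^dagger = rho for all sigma in S_{N+1} *)
Definition perm_invariant (D N : nat) (rho : op (tens_idx D N)) : Prop :=
  forall (sigma : {perm 'I_N.+1}) (s t : tens_idx D N),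
    rho [ffun k => s (sigma k)] [ffun k => t (sigma k)] = rho s t.

Definition unit_vector (D : nat) (Psi : 'I_D -> C) : Prop :=
  \sum_(i < D) (Psi i)^* * Psi i = 1.

Definition proj (D : nat) (Psi : 'I_D -> C) : op 'I_D :=
  fun i j => Psi i * (Psi j)^*.

Definition idop (D : nat) : op 'I_D := fun i j => (i == j)%:R.

Definition Omega (D : nat) (Psi : 'I_D -> C) (lam : R) : op 'I_D :=
  fun i j => proj Psi i j + real_complex R lam * (idop i j - proj Psi i j).

Definition OmN_tens (D N : nat) (Psi : 'I_D -> C) (lam : R) (B : op 'I_D) :
    op (tens_idx D N) :=
  tensor (fun k : 'I_N.+1 => if (k < N)%N then Omega Psi lam else B).

(* p_rho and f_rho (real parts of traces, which are real anyway) *)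
Definition p_rho (D N : nat) (Psi : 'I_D -> C) (lam : R) (rho : op (tens_idx D N)) : R :=
  complex.Re (trace (mulop (@OmN_tens D N Psi lam (@idop D)) rho)).

Definition f_rho (D N : nat) (Psi : 'I_D -> C) (lam : R) (rho : op (tens_idx D N)) : R :=
  complex.Re (trace (mulop (@OmN_tens D N Psi lam (proj Psi)) rho)).

(* F(N, delta, lambda) = min { f_rho / p_rho : p_rho >= delta } over
   permutation-invariant density operators (taken as an infimum). *)
Definition Fval (D N : nat) (Psi : 'I_D -> C) (delta lam : R) : R :=
  inf [set @f_rho D N Psi lam rho / @p_rho D N Psi lam rho | rho in
        [set rho : op (tens_idx D N) |
           density rho /\ perm_invariant rho /\ delta <= @p_rho D N Psi lam rho]].

Definition is_Nmin (D : nat) (Psi : 'I_D -> C) (eps delta lam : R) (n : nat) : Prop :=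
  (1 <= n)%N /\ 1 - eps <= @Fval D n Psi delta lam /\
  forall m : nat, (1 <= m)%N -> (m < n)%N -> ~ (1 - eps <= @Fval D m Psi delta lam).

End QDefs.

Definition log_base (R : realType) (b x : R) : R := ln x / ln b.

(* Main.v *)
Require Import Defs.
From HB Require Import structures.
From mathcomp Require Import all_boot all_order all_algebra.
From mathcomp Require Import complex fingroup perm.
From mathcomp Require Import all_classical all_reals all_analysis.
From mathcomp Require Import ring lra.
Import Order.TTheory GRing.Theory Num.Theory.
Local Open Scope ring_scope.

(** Expanding Omega = P + lam (1 - P) with P = |Psi><Psi|, both p_rho and f_rho
    become combinations of the numbers w_b = tr (Pi_b rho) >= 0, where the
    projector Pi_b has factor 1 - P at the sites selected by b and P elsewhere.
    Averaging over the site that is not measured, only j = |b| matters: the pair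
    (p_rho, f_rho) ranges over the convex hull of N + 2 points (p_j, f_j),
    0 <= j <= N + 1, all of which lie above the chord joining the points k and
    k + 1.  That chord passes through
    p = lam^k, f = lam^k (N - k) lam / (k + (N - k) lam).  For k = floor L,
    L = log_lam delta, this point is attained by a mixture of two states and
    gives the lower bound on N; evaluating the chord at p = delta gives the upper
    bounds, with k = ceil L for the first and k = floor L, together with the
    convexity of t |-> lam^t, for the second. *)

(** * Product operators on tensor powers *)

Section Tensor.
Context {R : realType} {D N : nat}.
Implicit Types (A B : 'I_N.+1 -> op R 'I_D) (s t : tens_idx D N).

Lemma trace_tensor A : trace (tensor A) = \prod_(k < N.+1) trace (A k).
Proof. by rewrite /trace bigA_distr_bigA. Qed.

Lemma mulop_tensor A B s t :
  mulop (tensor A) (tensor B) s t = tensor (fun k => mulop (A k) (B k)) s t.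
Proof.
rewrite /tensor /mulop bigA_distr_bigA.
by apply: eq_bigr => u _; rewrite big_split.
Qed.

Lemma eq_tensor A B s t :
  (forall k i j, A k i j = B k i j) -> tensor A s t = tensor B s t.
Proof. by move=> AB; apply: eq_bigr => k _; exact: AB. Qed.

Lemma tensor_perm A (sg : {perm 'I_N.+1}) s t :
  tensor A [ffun k => s (sg k)] [ffun k => t (sg k)]
  = tensor (fun k => A ((sg^-1)%g k)) s t.
Proof.
rewrite /tensor [RHS](reindex_inj (@perm_inj _ sg)) /=.
by apply: eq_bigr => k _; rewrite !ffunE permK.
Qed.

Lemma conj_tensor A s t :
  (tensor A s t)^* = tensor (fun k i j => (A k i j)^*) s t.
Proof. by rewrite /tensor rmorph_prod. Qed.

End Tensor.

(** * Positivity of traces against projectors *)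

Section Trace.
Context {R : realType} {T : finType}.
Implicit Types A rho : op R T.

Lemma trace_mulopC A rho : trace (mulop A rho) = trace (mulop rho A).
Proof.
rewrite /trace /mulop exchange_big; apply: eq_bigr => i _.
by apply: eq_bigr => j _; rewrite mulrC.
Qed.

Lemma trace_mulop_sum (I : finType) (c : I -> R) (A : I -> op R T) rho :
  trace (mulop (fun s t => \sum_i (c i)%:C%C * A i s t) rho)
  = \sum_i (c i)%:C%C * trace (mulop (A i) rho).
Proof.
rewrite /trace /mulop.
under [RHS]eq_bigr do rewrite mulr_sumr; rewrite [RHS]exchange_big.
apply: eq_bigr => s _.
under [RHS]eq_bigr do rewrite mulr_sumr; rewrite [RHS]exchange_big.
apply: eq_bigr => t _; rewrite mulr_suml.
by apply: eq_bigr => i _; rewrite mulrA.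
Qed.

(** Since [A] is its adjoint times itself, its quadratic form at [v] is the squared norm of [A]
    applied to [v]. *)
Lemma psd_projector A :
  (forall i j, (A i j)^* = A j i) ->
  (forall i j, mulop A A i j = A i j) -> psd A.
Proof.
move=> Ah A2 v.
have -> : \sum_i \sum_j (v i)^* * A i j * v j
  = \sum_k (\sum_j A k j * v j)^* * (\sum_j A k j * v j).
  under eq_bigr => i _ do under eq_bigr => j _ do
    rewrite -A2 /mulop mulr_sumr mulr_suml.
  under eq_bigr do rewrite exchange_big; rewrite exchange_big.
  apply: eq_bigr => k _; rewrite rmorph_sum mulr_suml.
  apply: eq_bigr => i _; rewrite mulr_sumr; apply: eq_bigr => j _.
  by rewrite rmorphM /= Ah; ring.
by apply: sumr_ge0 => k _; rewrite mulrC mul_conjC_ge0.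
Qed.

(** The trace equals that of A rho A, which sums the quadratic form of [rho] over the columns of
    [A]. *)
Lemma trace_projector_psd_ge0 A rho :
  (forall i j, (A i j)^* = A j i) ->
  (forall i j, mulop A A i j = A i j) ->
  psd rho -> 0 <= trace (mulop A rho).
Proof.
move=> Ah A2 rho_ge0.
have -> : trace (mulop A rho)
  = \sum_a \sum_i \sum_j (A i a)^* * rho i j * A j a.
  rewrite trace_mulopC exchange_big; apply: eq_bigr => i _.
  rewrite exchange_big; apply: eq_bigr => j _.
  rewrite -A2 /mulop mulr_sumr; apply: eq_bigr => a _.
  by rewrite Ah; ring.
by apply: sumr_ge0 => a _; exact: rho_ge0.
Qed.

End Trace.

Section Re.
Context {R : realType}.

Lemma Re_sum (I : finType) (P : pred I) (F : I -> R[i]) :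
  complex.Re (\sum_(i | P i) F i) = \sum_(i | P i) complex.Re (F i).
Proof. by apply: (big_morph (@complex.Re R)) => // -[a b] [c d]. Qed.

Lemma ReZ (a : R) (z : R[i]) : complex.Re (a%:C%C * z) = a * complex.Re z.
Proof. by case: z => x y /=; rewrite mul0r subr0. Qed.

End Re.

(** * Permutations of the sites *)

Section PermuteSites.
Context {N : nat} {T : Type}.

(** [T] is left general so that the same map acts on patterns ([bool]) and on basis indices
    (['I_D]). *)
Definition pat_perm (sg : {perm 'I_N.+1}) (b : {ffun 'I_N.+1 -> T}) :
  {ffun 'I_N.+1 -> T} := [ffun k => b (sg k)].

Lemma pat_perm_bij sg : bijective (pat_perm sg).
Proof.
by exists (pat_perm sg^-1%g) => b; apply/ffunP => k; rewrite !ffunE ?permK ?permKV.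
Qed.

End PermuteSites.

(** * The projectors Pi_b and the weights they give a state *)

Section Patterns.
Context {R : realType} {D : nat} (Psi : 'I_D -> R[i]).
Hypothesis Psi1 : unit_vector Psi.

(** Two complementary orthogonal projectors, of which every one-site factor in [p_rho] and [f_rho]
    is a combination: see [site_id], [site_proj] and [site_Omega]. *)
Definition site (b : bool) : op R 'I_D :=
  fun i j => if b then @idop R D i j - Defs.proj Psi i j else Defs.proj Psi i j.

Lemma site_conj b i j : (site b i j)^* = site b j i.
Proof.
have projC : (Defs.proj Psi i j)^* = Defs.proj Psi j i.
  by rewrite /Defs.proj rmorphM /= conjCK mulrC.
by case: b; rewrite /site //= rmorphB /= projC /idop rmorph_nat eq_sym.
Qed.

Lemma mulop_proj i j :
  mulop (Defs.proj Psi) (Defs.proj Psi) i j = Defs.proj Psi i j.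
Proof.
rewrite /mulop /Defs.proj.
transitivity (\sum_k (Psi k)^* * Psi k * (Psi i * (Psi j)^*)).
  by apply: eq_bigr => k _; ring.
by rewrite -mulr_suml Psi1 mul1r.
Qed.

Lemma mulop_id_l (A : op R 'I_D) i j : mulop (@idop R D) A i j = A i j.
Proof.
rewrite /mulop /idop (bigD1 i) //= eqxx mul1r big1 ?addr0 // => k.
by rewrite eq_sym => /negbTE ->; rewrite mul0r.
Qed.

Lemma mulop_id_r (A : op R 'I_D) i j : mulop A (@idop R D) i j = A i j.
Proof.
rewrite /mulop /idop (bigD1 j) //= eqxx mulr1 big1 ?addr0 // => k.
by move=> /negbTE ->; rewrite mulr0.
Qed.

Lemma mulop_site b c i j :
  mulop (site b) (site c) i j = (b == c)%:R * site b i j.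
Proof.
have Pl := mulop_proj i j.
have I1 := mulop_id_l (Defs.proj Psi) i j.
have I2 := mulop_id_r (Defs.proj Psi) i j.
have I3 := mulop_id_r (@idop R D) i j.
move: Pl I1 I2 I3; rewrite /mulop => Pl I1 I2 I3.
case: b; case: c; rewrite /site /= ?mul1r ?mul0r //.
- under eq_bigr do rewrite mulrBr !mulrBl.
  by rewrite !sumrB Pl I1 I2 I3 subrr subr0.
- by under eq_bigr do rewrite mulrBl; rewrite sumrB Pl I1 subrr.
- by under eq_bigr do rewrite mulrBr; rewrite sumrB Pl I2 subrr.
Qed.

Lemma trace_site b : trace (site b) = if b then D%:R - 1 else 1.
Proof.
have P1 : \sum_i Defs.proj Psi i i = 1.
  by rewrite -Psi1; apply: eq_bigr => i _; rewrite mulrC.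
case: b; rewrite /trace /site //= sumrB P1; congr (_ - _).
by rewrite /idop; under eq_bigr do rewrite eqxx; rewrite sumr_const card_ord.
Qed.

Context {N : nat}.
Notation pattern := {ffun 'I_N.+1 -> bool}.
Implicit Types b c : pattern.

Definition pat_op b : op R (tens_idx D N) := tensor (fun k => site (b k)).

Definition weight b : nat := \sum_k b k.

Lemma pat_op_conj b s t : (pat_op b s t)^* = pat_op b t s.
Proof.
by rewrite /pat_op conj_tensor; apply: eq_bigr => k _; rewrite site_conj.
Qed.

Lemma mulop_pat_op b c s t :
  mulop (pat_op b) (pat_op c) s t = (b == c)%:R * pat_op b s t.
Proof.
rewrite mulop_tensor.
under eq_tensor do rewrite mulop_site.
rewrite /tensor big_split /=; congr (_ * _).
case: eqP => [->|neq]; first by rewrite big1 // => k _; rewrite eqxx.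
have [k bck] : exists k, b k != c k.
  apply/existsP; rewrite -negb_forall; apply: contra_notN neq => /forallP E.
  by apply/ffunP => k; apply/eqP.
by rewrite (bigD1 k) //= (negbTE bck) mul0r.
Qed.

Lemma pat_op_idem b s t : mulop (pat_op b) (pat_op b) s t = pat_op b s t.
Proof. by rewrite mulop_pat_op eqxx mul1r. Qed.

Lemma trace_pat_op b : trace (pat_op b) = (D%:R - 1) ^+ weight b.
Proof.
rewrite trace_tensor /weight -prodrXr; apply: eq_bigr => k _.
by rewrite trace_site; case: (b k); rewrite ?expr1 ?expr0.
Qed.

Lemma weight_perm sg b : weight (pat_perm sg b) = weight b.
Proof.
rewrite /weight [RHS](reindex_inj (@perm_inj _ sg)) /=.
by apply: eq_bigr => k _; rewrite ffunE.
Qed.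

Lemma pat_op_perm (sg : {perm 'I_N.+1}) b (s t : tens_idx D N) :
  pat_op b [ffun k => s (sg k)] [ffun k => t (sg k)]
  = pat_op (pat_perm sg^-1 b) s t.
Proof. by rewrite /pat_op tensor_perm; apply: eq_tensor => k i j; rewrite ffunE. Qed.

Lemma sum_pat_op (c : 'I_N.+1 -> bool -> R) s t :
  tensor (fun k i j => \sum_b (c k b)%:C%C * site b i j) s t
  = \sum_(b : pattern) (\prod_k c k (b k))%:C%C * pat_op b s t.
Proof.
rewrite /tensor bigA_distr_bigA; apply: eq_bigr => b _.
by rewrite big_split /= rmorph_prod.
Qed.

(** The number w_b. For a density operator these form a probability distribution on patterns, by
    [pat_weight_ge0] and [sum_pat_weight]. *)
Definition pat_weight (rho : op R (tens_idx D N)) b : R :=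
  complex.Re (trace (mulop (pat_op b) rho)).

Lemma pat_weight_ge0 rho b : psd rho -> 0 <= pat_weight rho b.
Proof.
move=> /(trace_projector_psd_ge0 _ _ (pat_op_conj b) (pat_op_idem b)).
by rewrite lecE => /andP[].
Qed.

(** Multiplying out the sites leaves a combination of the Pi_b. The formulas for [p_rho], [f_rho]
    and the total weight are instances. *)
Lemma tensor_weight (c : 'I_N.+1 -> bool -> R) (A : 'I_N.+1 -> op R 'I_D) rho :
  (forall k i j, A k i j = \sum_b (c k b)%:C%C * site b i j) ->
  complex.Re (trace (mulop (tensor A) rho))
  = \sum_(b : pattern) (\prod_k c k (b k)) * pat_weight rho b.
Proof.
move=> Ac; under [RHS]eq_bigr do rewrite -ReZ.
rewrite -Re_sum -trace_mulop_sum; congr complex.Re.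
apply: eq_bigr => s _; apply: eq_bigr => t _; congr (_ * _).
by rewrite -sum_pat_op; apply: eq_tensor.
Qed.

Lemma site_id i j : @idop R D i j = \sum_b ((1 : R)%:C)%C * site b i j.
Proof. by rewrite big_bool /site /= -mulrDr subrK mul1r. Qed.

Lemma site_proj i j : Defs.proj Psi i j = \sum_b ((~~ b)%:R : R)%:C%C * site b i j.
Proof. by rewrite big_bool /site /= rmorph0 rmorph1 mul0r add0r mul1r. Qed.

Lemma site_Omega lam i j :
  Omega Psi lam i j = \sum_b ((if b then lam else 1) : R)%:C%C * site b i j.
Proof. by rewrite big_bool /site /Omega /= mul1r addrC. Qed.

Lemma sum_pat_weight rho : trace rho = 1 -> \sum_(b : pattern) pat_weight rho b = 1.
Proof.
move=> rho1; transitivity (complex.Re (trace (mulop (tensor (fun=> @idop R D)) rho))).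
  rewrite (tensor_weight (fun _ (_ : bool) => 1)); last by move=> *; exact: site_id.
  by apply: eq_bigr => b _; rewrite big1 ?mul1r.
have tid s t : tensor (fun=> @idop R D) s t = (s == t)%:R :> R[i].
  rewrite /tensor /idop; case: eqP => [->|neq].
    by rewrite big1 // => k _; rewrite eqxx.
  have [k stk] : exists k, s k != t k.
    apply/existsP; rewrite -negb_forall; apply: contra_notN neq => /forallP E.
    by apply/ffunP => k; apply/eqP.
  by rewrite (bigD1 k) //= (negbTE stk) mul0r.
transitivity (complex.Re (trace rho)); last by rewrite rho1.
congr complex.Re; apply: eq_bigr => s _; rewrite /mulop (bigD1 s) //= tid eqxx mul1r.
rewrite big1 ?addr0 // => t; rewrite eq_sym => /negbTE st.
by rewrite tid st mul0r.
Qed.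

Lemma weightD1 b : weight b = (\sum_(k < N) b (widen_ord (leqnSn N) k) + b ord_max)%N.
Proof. by rewrite /weight big_ord_recr. Qed.

(** Only the first [N] sites can contribute a factor [lam], so the last one is removed from the
    count. *)
Lemma p_rho_weights (lam : R) rho :
  p_rho Psi lam rho
  = \sum_(b : pattern) lam ^+ (weight b - b ord_max) * pat_weight rho b.
Proof.
rewrite /p_rho /OmN_tens.
rewrite (tensor_weight (fun k (b : bool) => if (k < N)%N then if b then lam else 1 else 1)).
  apply: eq_bigr => b _; congr (_ * _).
  rewrite weightD1 addnK big_ord_recr /= ltnn mulr1 -prodrXr.
  apply: eq_bigr => k _; rewrite ltn_ord.
  by case: (b _); rewrite ?expr1 ?expr0.
move=> k i j; case: (k < N)%N; [exact: site_Omega|exact: site_id].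
Qed.

Lemma f_rho_weights (lam : R) rho :
  f_rho Psi lam rho
  = \sum_(b : pattern) (~~ b ord_max)%:R * lam ^+ weight b * pat_weight rho b.
Proof.
rewrite /f_rho /OmN_tens.
rewrite (tensor_weight (fun k (b : bool) => if (k < N)%N then if b then lam else 1 else (~~ b)%:R)).
  apply: eq_bigr => b _; congr (_ * _).
  rewrite weightD1 big_ord_recr /= ltnn mulrC.
  case: (b ord_max); rewrite ?mul0r // !mul1r addn0 -prodrXr.
  apply: eq_bigr => k _; rewrite ltn_ord.
  by case: (b _); rewrite ?expr1 ?expr0.
move=> k i j; case: (k < N)%N; [exact: site_Omega|exact: site_proj].
Qed.

Lemma pat_weight_perm rho sg b :
  perm_invariant rho -> pat_weight rho (pat_perm sg b) = pat_weight rho b.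
Proof.
move=> rho_inv; congr complex.Re; rewrite /trace /mulop.
pose h : tens_idx D N -> tens_idx D N := pat_perm sg.
have h_bij : bijective h by exact: pat_perm_bij.
rewrite (reindex h) /=; last exact: onW_bij.
apply: eq_bigr => s _; rewrite (reindex h) /=; last exact: onW_bij.
apply: eq_bigr => t _; rewrite rho_inv pat_op_perm; congr (pat_op _ _ _ * _).
by apply/ffunP => k; rewrite !ffunE permKV.
Qed.

(** The transposition of [k] and [ord_max] shows that every site [k] gives the same sum as the last
    one; adding the indicators [b k] over all sites gives [weight b]. *)
Lemma symmetric_average (w : pattern -> R) (g : nat -> R) :
  (forall sg b, w (pat_perm sg b) = w b) ->
  N.+1%:R * \sum_(b : pattern) (b ord_max)%:R * g (weight b) * w b
  = \sum_(b : pattern) (weight b)%:R * g (weight b) * w b.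
Proof.
move=> w_inv.
have E k : \sum_(b : pattern) (b ord_max)%:R * g (weight b) * w b
         = \sum_(b : pattern) (b k)%:R * g (weight b) * w b.
  rewrite (reindex (pat_perm (tperm k ord_max))); last exact/onW_bij/pat_perm_bij.
  by apply: eq_bigr => b _; rewrite weight_perm w_inv ffunE tpermR.
transitivity (\sum_k \sum_(b : pattern) (b k)%:R * g (weight b) * w b).
  rewrite -(eq_bigr _ (fun k _ => E k)) sumr_const card_ord.
  by rewrite mulr_natl.
rewrite exchange_big; apply: eq_bigr => b _.
by rewrite -!mulr_suml /weight natr_sum.
Qed.

End Patterns.

(** * Reduction to the number of orthogonal sites *)

Section Levels.
Context {R : realType}.
Implicit Types (lam : R) (N j : nat).

(* The values of [p_rho] and [f_rho] on the symmetrized state with exactly [j]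
   of the [N + 1] sites orthogonal to [Psi]. *)
Definition p_level N lam j : R :=
  (j%:R * lam ^+ j.-1 + (N.+1%:R - j%:R) * lam ^+ j) / N.+1%:R.

Definition f_level N lam j : R := (N.+1%:R - j%:R) * lam ^+ j / N.+1%:R.

End Levels.

Section Reduction.
Context {R : realType} {D N : nat} (Psi : 'I_D -> R[i]) (lam : R).
Hypothesis Psi1 : unit_vector Psi.
Notation pattern := {ffun 'I_N.+1 -> bool}.
Implicit Types (b : pattern) (rho : op R (tens_idx D N)).

Lemma f_rho_levels rho : perm_invariant rho ->
  f_rho Psi lam rho = \sum_b f_level N lam (weight b) * pat_weight Psi rho b.
Proof.
move=> rho_inv; rewrite f_rho_weights //.
have w_inv sg b := pat_weight_perm Psi rho sg b rho_inv.
have av := symmetric_average _ (GRing.exp lam) w_inv.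
have N0 : N.+1%:R != 0 :> R by rewrite pnatr_eq0.
apply: (mulfI N0).
(* The indicator of [~~ b ord_max] is split as 1 minus that of [b ord_max], the form that [av]
   averages. *)
transitivity (N.+1%:R * \sum_(b : pattern) lam ^+ weight b * pat_weight Psi rho b
  - N.+1%:R * \sum_(b : pattern) (b ord_max)%:R * lam ^+ weight b * pat_weight Psi rho b).
  rewrite -mulrBr -sumrB; congr (_ * _); apply: eq_bigr => b _.
  by case: (b _) => /=; ring.
rewrite av !mulr_sumr -sumrB; apply: eq_bigr => b _.
by move: N0; rewrite /f_level; move: (N.+1%:R : R) => M M0; field.
Qed.

Lemma p_rho_levels rho : perm_invariant rho ->
  p_rho Psi lam rho = \sum_b p_level N lam (weight b) * pat_weight Psi rho b.
Proof.
move=> rho_inv; rewrite p_rho_weights //.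
have w_inv sg b := pat_weight_perm Psi rho sg b rho_inv.
have av := symmetric_average _ (fun j => lam ^+ j.-1) w_inv.
have N0 : N.+1%:R != 0 :> R by rewrite pnatr_eq0.
apply: (mulfI N0).
(* The patterns orthogonal at the last site are what [p_rho] has beyond [f_rho], with exponent one
   less than the weight. The value of [.-1] at 0 is harmless, as its coefficient vanishes there. *)
transitivity (N.+1%:R * f_rho Psi lam rho
  + N.+1%:R * \sum_(b : pattern) (b ord_max)%:R * lam ^+ (weight b).-1 * pat_weight Psi rho b).
  rewrite -mulrDr f_rho_weights // -big_split; congr (_ * _); apply: eq_bigr => b _ /=.
  by case: (b _) => /=; rewrite ?subn1 ?subn0; ring.
rewrite av f_rho_levels // !mulr_sumr -big_split; apply: eq_bigr => b _ /=.
by move: N0; rewrite /f_level /p_level; move: (N.+1%:R : R) => M M0; field.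
Qed.

(** The pair (p, f) of a state is a convex combination of the level points, so an affine inequality
    valid at every level passes to the state. *)
Lemma affine_bound (x y z : R) rho :
  density rho -> perm_invariant rho ->
  (forall j, (j <= N.+1)%N -> 0 <= x * f_level N lam j + y * p_level N lam j + z) ->
  0 <= x * f_rho Psi lam rho + y * p_rho Psi lam rho + z.
Proof.
move=> [rho_ge0 rho1] rho_inv H.
rewrite f_rho_levels // p_rho_levels // -[z]mulr1 -(sum_pat_weight Psi rho rho1).
rewrite !mulr_sumr -!big_split; apply: sumr_ge0 => b _ /=.
rewrite (_ : _ + _ = (x * f_level N lam (weight b) + y * p_level N lam (weight b) + z)
  * pat_weight Psi rho b); last by ring.
apply: mulr_ge0; last exact: pat_weight_ge0.
apply: H.
rewrite -[X in (_ <= X)%N]card_ord -sum1_card /weight.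
by apply: leq_sum => k _; case: (b k).
Qed.

Lemma trace_mulop_mix (A r1 r2 : op R (tens_idx D N)) (x y : R) :
  complex.Re (trace (mulop A (fun s t => x%:C%C * r1 s t + y%:C%C * r2 s t)))
  = x * complex.Re (trace (mulop A r1)) + y * complex.Re (trace (mulop A r2)).
Proof.
rewrite -!ReZ /trace /mulop !mulr_sumr.
set S1 := \sum_i x%:C%C * _; set S2 := \sum_i y%:C%C * _.
transitivity (complex.Re (S1 + S2)); last by case: S1 S2 => [? ?] [? ?].
congr complex.Re; rewrite -big_split; apply: eq_bigr => s _ /=.
rewrite !mulr_sumr -big_split; apply: eq_bigr => t _ /=; ring.
Qed.

(** Lets every point of the segment between two attained points be attained. *)
Lemma mixture (r1 r2 : op R (tens_idx D N)) (x : R) :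
  0 <= x <= 1 -> density r1 -> perm_invariant r1 ->
  density r2 -> perm_invariant r2 ->
  exists rho : op R (tens_idx D N), [/\ density rho, perm_invariant rho,
    p_rho Psi lam rho = x * p_rho Psi lam r1 + (1 - x) * p_rho Psi lam r2 &
    f_rho Psi lam rho = x * f_rho Psi lam r1 + (1 - x) * f_rho Psi lam r2].
Proof.
move=> /andP[x0 x1] [r1p r11] r1i [r2p r21] r2i.
exists (fun s t => x%:C%C * r1 s t + (1 - x)%:C%C * r2 s t); split.
- split=> [v|].
    rewrite (_ : \sum_i _ = x%:C%C * (\sum_i \sum_j (v i)^* * r1 i j * v j)
      + (1 - x)%:C%C * (\sum_i \sum_j (v i)^* * r2 i j * v j)).
      by rewrite addr_ge0 // mulr_ge0 // ?ler0c ?subr_ge0.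
    rewrite !mulr_sumr -big_split; apply: eq_bigr => i _ /=.
    by rewrite !mulr_sumr -big_split; apply: eq_bigr => j _ /=; ring.
  by rewrite /trace big_split /= -!mulr_sumr -/(trace r1) -/(trace r2) r11 r21
       !mulr1 -rmorphD /= addrC subrK.
- by move=> sg s t; rewrite r1i r2i.
- exact: trace_mulop_mix.
- exact: trace_mulop_mix.
Qed.

End Reduction.

(** * Symmetric states attaining the level points *)

Section States.
Context {R : realType} {D N : nat} (Psi : 'I_D -> R[i]) (lam : R).
Hypotheses (D2 : (2 <= D)%N) (Psi1 : unit_vector Psi).
Notation pattern := {ffun 'I_N.+1 -> bool}.
Implicit Types (b : pattern).

Lemma level_inhabited j : (j <= N.+1)%N ->
  (0 < #|[pred b : pattern | weight b == j]|)%N.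
Proof.
move=> jN; apply/card_gt0P; exists [ffun k : 'I_N.+1 => (k < j)%N].
rewrite inE /weight; under eq_bigr do rewrite ffunE.
apply/eqP; transitivity (\sum_(k < N.+1 | (k < j)%N) 1)%N.
  by rewrite [RHS]big_mkcond; apply: eq_bigr => k _; case: ltnP.
by rewrite -(big_ord_widen _ (fun=> 1%N) jN) sum1_card card_ord.
Qed.

Lemma level_state j : (j <= N.+1)%N ->
  exists rho : op R (tens_idx D N), [/\ density rho, perm_invariant rho,
    p_rho Psi lam rho = p_level N lam j & f_rho Psi lam rho = f_level N lam j].
Proof.
move=> /level_inhabited; set n := #|_| => n0.
pose d : R := D%:R - 1.
have d0 : 0 < d by rewrite subr_gt0 ltr1n.
have dC : D%:R - 1 = d%:C%C :> R[i] by rewrite rmorphB rmorph_nat rmorph1.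
(* Each of the [n] projectors of weight [j] has trace [d ^+ j], so this common coefficient gives
   total trace 1; [D2] makes [d] positive. *)
pose x b : R := if weight b == j then (n%:R * d ^+ j)^-1 else 0.
have x0 b : 0 <= x b by rewrite /x; case: ifP; rewrite // invr_ge0 mulr_ge0 ?exprn_ge0 // ltW.
have xd b : x b * d ^+ weight b = if weight b == j then n%:R^-1 else 0.
  rewrite /x; case: eqP => [->|_]; last by rewrite mul0r.
  by rewrite invfM -mulrA mulVf ?mulr1 // expf_neq0 ?gt_eqF.
have sum_level (g : nat -> R) :
    \sum_(b : pattern) g (weight b) * (if weight b == j then n%:R^-1 else 0) = g j.
  transitivity (\sum_(b : pattern | weight b == j) g j / n%:R).
    by rewrite [RHS]big_mkcond; apply: eq_bigr => b _; case: eqP => [->|]; rewrite ?mulr0.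
  rewrite sumr_const (_ : #|_| = n); last exact: eq_card.
  by rewrite -[LHS]mulr_natr divfK // pnatr_eq0 -lt0n.
pose rho : op R (tens_idx D N) := fun s t => \sum_(b : pattern) (x b)%:C%C * pat_op Psi b s t.
have rho_inv : perm_invariant rho.
  move=> sg s t; rewrite /rho [RHS](reindex (pat_perm (sg^-1)%g)); last exact/onW_bij/pat_perm_bij.
  by apply: eq_bigr => b _; rewrite pat_op_perm /x weight_perm.
(* Distinct Pi_b are orthogonal, so only the term of [b] itself survives: the weights are uniform on
   level [j]. *)
have w_rho b : pat_weight Psi rho b = if weight b == j then n%:R^-1 else 0.
  rewrite /pat_weight trace_mulopC trace_mulop_sum (bigD1 b) //= big1 ?addr0.
    rewrite (_ : trace _ = trace (pat_op Psi b)); last first.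
      by apply: eq_bigr => s _; rewrite pat_op_idem.
    by rewrite trace_pat_op // dC -rmorphXn -rmorphM /= xd.
  move=> c cb; rewrite (_ : trace _ = 0) ?mulr0 //.
  by apply: big1 => s _; rewrite mulop_pat_op // (negbTE cb) mul0r.
exists rho; split=> //.
- split=> [v|].
    rewrite (_ : \sum_i _ = \sum_(b : pattern) (x b)%:C%C *
      (\sum_i \sum_j (v i)^* * pat_op Psi b i j * v j)); last first.
      under [RHS]eq_bigr do rewrite mulr_sumr; rewrite [RHS]exchange_big.
      apply: eq_bigr => s _.
      under [RHS]eq_bigr do rewrite mulr_sumr; rewrite [RHS]exchange_big.
      apply: eq_bigr => t _; rewrite mulr_sumr mulr_suml.
      by apply: eq_bigr => b _; ring.
    apply: sumr_ge0 => b _; rewrite mulr_ge0 ?ler0c //.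
    by apply: psd_projector; [exact: pat_op_conj|exact: pat_op_idem].
  rewrite /trace exchange_big.
  transitivity (\sum_(b : pattern) (x b * d ^+ weight b)%:C%C).
    apply: eq_bigr => b _; rewrite -mulr_sumr -/(trace _) trace_pat_op //.
    by rewrite dC rmorphM rmorphXn.
  rewrite -rmorph_sum -[RHS](rmorph1 (real_complex R)); congr (_%:C%C).
  rewrite -[RHS](sum_level (fun=> 1)); apply: eq_bigr => b _.
  by rewrite xd mul1r.
- rewrite p_rho_levels // -[RHS]sum_level.
  by apply: eq_bigr => b _; rewrite w_rho.
- rewrite f_rho_levels // -[RHS]sum_level.
  by apply: eq_bigr => b _; rewrite w_rho.
Qed.

End States.

(** * Convexity inequalities for powers of [lam] *)

Section Inequalities.
Context {R : realType} (lam : R).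
Hypothesis lam01 : 0 < lam < 1.
Let lam0 : 0 < lam. Proof. by case/andP: lam01. Qed.
Let lam1 : lam < 1. Proof. by case/andP: lam01. Qed.
Let lamX1 n : lam ^+ n <= 1. Proof. by rewrite exprn_ile1 ?ltW. Qed.
Let lamX0 n : 0 <= lam ^+ n. Proof. by rewrite exprn_ge0 ?ltW. Qed.

(** After division by [lam ^+ j] and with m = k - j, this says that the convex function lam^(m+1)
    lies, at integers m, above its chord through m = -1 and m = 0. Here [up] treats m >= 0, and
    [down] treats m = -n, multiplied by [lam ^+ n]. *)
Lemma geometric_tangent (k j : nat) :
  lam ^+ j.+1 <= (k%:R - j%:R) * (1 - lam) * lam ^+ j + lam ^+ k.+1.
Proof.
have up m : lam <= m%:R * (1 - lam) + lam ^+ m.+1.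
  elim: m => [|m IHm]; first by rewrite mul0r add0r expr1.
  apply: (le_trans IHm); rewrite -subr_ge0 -(natr1 m).
  rewrite (_ : _ - _ = (1 - lam) * (1 - lam ^+ m.+1)); last by rewrite (exprS _ m.+1); ring.
  by rewrite mulr_ge0 ?subr_ge0 // ltW.
have down n : lam ^+ n.+1 + n%:R * (1 - lam) * lam ^+ n <= lam.
  elim: n => [|n IHn]; first by rewrite mul0r mul0r addr0 expr1.
  rewrite (_ : _ + _ = lam * (lam ^+ n.+1 + n%:R * (1 - lam) * lam ^+ n)
    + (1 - lam) * (lam * lam ^+ n)); last by rewrite -(natr1 n) !exprS; ring.
  have h1 : lam * (lam ^+ n.+1 + n%:R * (1 - lam) * lam ^+ n) <= lam * lam.
    by rewrite ler_pM2l.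
  have h2 : (1 - lam) * (lam * lam ^+ n) <= (1 - lam) * lam.
    by rewrite ler_pM2l ?subr_gt0 // ler_piMr // ltW.
  by apply: (le_trans (lerD h1 h2)); rewrite -mulrDl addrC subrK mul1r.
have [jk|kj] := leqP j k.
  have := ler_wpM2l (lamX0 j) (up (k - j)%N).
  by rewrite natrB // -exprSr mulrDr -exprD addnS subnKC // mulrC -!mulrA [_ * lam ^+ j]mulrC.
have := ler_wpM2l (lamX0 k) (down (j - k)%N).
rewrite natrB ?(ltnW kj) // -exprSr mulrDr -exprD addnS subnKC ?(ltnW kj) //.
rewrite [lam ^+ k * _]mulrCA -exprD subnKC ?(ltnW kj) // => h; lra.
Qed.

(* The chord of the curve [(p_level N lam j, f_level N lam j)] through [j = k]
   and [j = k + 1], where equality holds, lies below all its points. *)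
Lemma level_chord (N k j : nat) :
  0 <= (1 - lam) * (k%:R + (N%:R - k%:R) * lam) * f_level N lam j
     + - ((1 - lam) * (N%:R - k%:R) * lam + lam) * p_level N lam j + lam ^+ k.+1.
Proof.
(* The expression is identically the slack in [geometric_tangent]; [j = 0] is separated only because
   of [j.-1]. *)
have h := geometric_tangent k j; rewrite -subr_ge0 in h; apply: (le_trans h); clear h.
rewrite le_eqVlt; apply/orP; left; apply/eqP; rewrite /f_level /p_level.
have : N.+1%:R != 0 :> R by rewrite pnatr_eq0.
rewrite -(natr1 N) => N0; case: j => [|j]; first by rewrite !expr0 expr1; field.
by rewrite /= -(natr1 j) !exprS; field.
Qed.

Lemma f_level_ge0 (N j : nat) : (j <= N.+1)%N -> 0 <= f_level N lam j.
Proof.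
by move=> jN; rewrite /f_level divr_ge0 ?mulr_ge0 // subr_ge0 ler_nat.
Qed.

(** Convexity of exp between 0 and [ln lam], with weight [t] at 0. *)
Lemma powR_le_chord (t : R) : 0 <= t <= 1 -> lam `^ (1 - t) <= t + (1 - t) * lam.
Proof.
move=> /andP[t0 t1]; rewrite /powR gt_eqF //.
have := convex_expR (Itv01 t0 t1) 0 (ln lam).
by rewrite !convRE /= expR0 lnK ?posrE // mulr0 add0r mulr1.
Qed.

End Inequalities.

(** * Comparing [Fval] with [1 - eps] *)

Section Threshold.
Context {R : realType} {D : nat} (Psi : 'I_D -> R[i]) (eps delta lam : R).
Hypotheses (D2 : (2 <= D)%N) (Psi1 : unit_vector Psi).
Hypotheses (eps01 : 0 < eps < 1) (delta01 : 0 < delta < 1) (lam01 : 0 < lam < 1).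

(* The hypothesis says that the chord through [k] and [k + 1] lies above
   [f = (1 - eps) p] at [p = delta]. *)
Lemma Fval_ge (N k : nat) : (0 < N)%N -> (k <= N)%N ->
  lam ^+ k.+1 <= delta * ((1 - lam) * ((N%:R - k%:R) * lam * eps - (1 - eps) * k%:R) + lam) ->
  1 - eps <= Fval N Psi delta lam.
Proof.
move=> N0 kN hk; case/andP: (delta01) => d0 d1; case/andP: (lam01) => l0 l1.
set B := (X in delta * X) in hk.
have B0 : 0 < B by rewrite -(pmulr_rgt0 _ d0) (lt_le_trans _ hk) // exprn_gt0.
apply: lb_le_inf.
  (* The infimum needs an admissible state: level 0 has p = 1. *)
  have [rho [rho_d rho_i rho_p _]] := level_state (N := N) Psi lam D2 Psi1 0 isT.
  exists (f_rho Psi lam rho / p_rho Psi lam rho), rho => //; split=> //; split=> //.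
  by rewrite rho_p /p_level mul0r add0r subr0 expr0 mulr1 divff ?pnatr_eq0 // ltW.
move=> _ [rho [rho_d [rho_i p_ge]] <-].
have chord := affine_bound Psi lam Psi1 _ _ _ rho rho_d rho_i
  (fun j _ => level_chord lam lam01 N k j).
set p := p_rho Psi lam rho in p_ge chord *; set f := f_rho Psi lam rho in chord *.
rewrite ler_pdivlMr ?(lt_le_trans d0) //.
set e := k%:R + (N%:R - k%:R) * lam in chord.
have e0 : 0 < e.
  rewrite /e; have [->|k0] := posnP k; first by rewrite add0r subr0 mulr_gt0 ?ltr0n.
  by rewrite ltr_wpDr ?ltr0n // mulr_ge0 ?subr_ge0 ?ler_nat ?ltW.
have a0 : 0 < (1 - lam) * e by rewrite mulr_gt0 ?subr_gt0.
rewrite -(ler_pM2l a0) -subr_ge0.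
(* As [B] is positive, the condition at [delta] extends to every [p >= delta]. Subtracting the chord
   inequality from the goal leaves exactly this one. *)
have h : lam ^+ k.+1 <= p * B by rewrite (le_trans hk) // ler_pM2r.
apply: (le_trans chord); rewrite -subr_ge0.
rewrite (_ : _ - _ = p * B - lam ^+ k.+1) ?subr_ge0 // /B /e; ring.
Qed.

(** For [inf] to lie below a member, the set must have a lower bound; 0 serves, since f is
    nonnegative at every level. *)
Lemma Fval_le (N : nat) (rho : op R (tens_idx D N)) :
  density rho -> perm_invariant rho -> delta <= p_rho Psi lam rho ->
  Fval N Psi delta lam <= f_rho Psi lam rho / p_rho Psi lam rho.
Proof.
move=> rho_d rho_i p_ge; apply: ge_inf; last by exists rho.
exists 0 => _ [r [r_d [r_i r_p]] <-].
case/andP: (delta01) => d0 _; apply: divr_ge0; last exact: le_trans (ltW d0) r_p.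
have -> : f_rho Psi lam r = 1 * f_rho Psi lam r + 0 * p_rho Psi lam r + 0 by ring.
apply: affine_bound => // j jN.
by rewrite mul1r mul0r !addr0 f_level_ge0.
Qed.

Lemma Fval_lt (N k : nat) : (0 < k)%N -> delta <= lam ^+ k ->
  (N%:R - k%:R) * lam * eps < (1 - eps) * k%:R ->
  Fval N Psi delta lam < 1 - eps.
Proof.
move=> k0 dk Nk; case/andP: (eps01) => e0 e1; case/andP: (lam01) => l0 l1.
have N0 : N.+1%:R != 0 :> R by rewrite pnatr_eq0.
have [kN|{}Nk] := leqP k N; last first.
  (* When [N < k], the state with all sites orthogonal is admissible, with p = lam^N and f = 0. *)
  have [rho [rho_d rho_i rho_p rho_f]] := level_state Psi lam D2 Psi1 N.+1 (leqnn _).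
  have p_ge : delta <= p_rho Psi lam rho.
    rewrite rho_p /p_level subrr mul0r addr0 mulrAC divff // mul1r.
    exact: le_trans dk (ler_wiXn2l (ltW l0) (ltW l1) (ltnW Nk)).
  apply: (le_lt_trans (Fval_le N rho rho_d rho_i p_ge)).
  by rewrite rho_f /f_level subrr !mul0r subr_gt0.
have [r1 [r1_d r1_i r1_p r1_f]] := level_state Psi lam D2 Psi1 k (leqW kN).
have [r2 [r2_d r2_i r2_p r2_f]] := level_state Psi lam D2 Psi1 k.+1 kN.
set e := k%:R + (N%:R - k%:R) * lam.
have NkR : 0 <= (N%:R - k%:R) * lam by rewrite mulr_ge0 ?subr_ge0 ?ler_nat ?ltW.
have e_gt0 : 0 < e by rewrite /e ltr_wpDr ?ltr0n.
have e_neq0 : e != 0 by rewrite gt_eqF.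
(* The weight of level [k] is chosen so that the mixture has p exactly [lam ^+ k]; the ratio f / p
   is then this weight itself. *)
have x01 : 0 <= (N%:R - k%:R) * lam / e <= 1.
  by rewrite divr_ge0 ?(ltW e_gt0) //= ler_pdivrMr // mul1r /e lerDr.
have [rho [rho_d rho_i rho_p rho_f]] := mixture Psi lam r1 r2 _ x01 r1_d r1_i r2_d r2_i.
have pE : p_rho Psi lam rho = lam ^+ k.
  rewrite rho_p r1_p r2_p /p_level; move: N0 e_neq0; rewrite /e -(prednK k0) /=.
  rewrite -(natr1 k.-1.+1) -(natr1 k.-1) -(natr1 N) !exprS => N0 E.
  by field; rewrite N0 E.
have fE : f_rho Psi lam rho = (N%:R - k%:R) * lam / e * lam ^+ k.
  rewrite rho_f r1_f r2_f /f_level -(natr1 k) exprS.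
  move: N0 e_neq0; rewrite /e -(natr1 N) => N0 E.
  by field; rewrite N0 E.
apply: le_lt_trans (Fval_le N rho rho_d rho_i _) _; first by rewrite pE.
rewrite pE fE mulfK ?gt_eqF ?exprn_gt0 // ltr_pdivrMr // /e; lra.
Qed.

End Threshold.

(** * Powers of [lam] and the logarithm of [delta] *)

Section LogBase.
Context {R : realType} (delta lam : R).
Hypotheses (delta01 : 0 < delta < 1) (lam01 : 0 < lam < 1).

Lemma log_base_gt0 : 0 < log_base lam delta.
Proof. by rewrite /log_base -mulrNN -invrN divr_gt0 // oppr_gt0 ln_lt0. Qed.

Lemma powR_log_base : lam `^ log_base lam delta = delta.
Proof.
case/andP: (delta01) => d0 _; case/andP: (lam01) => l0 _.
by rewrite /powR gt_eqF // /log_base divfK ?lnK ?posrE // lt_eqF // ln_lt0.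
Qed.

Lemma exp_le_of_log (k : nat) : log_base lam delta <= k%:R -> lam ^+ k <= delta.
Proof.
case/andP: (lam01) => l0 l1 Lk.
rewrite -[leRHS]powR_log_base -powR_mulrn ?(ltW l0) //.
by rewrite ger_powR // l0 ltW.
Qed.

Lemma le_exp_of_log (k : nat) : k%:R <= log_base lam delta -> delta <= lam ^+ k.
Proof.
case/andP: (lam01) => l0 l1 Lk.
rewrite -[leLHS]powR_log_base -powR_mulrn ?(ltW l0) //.
by rewrite ger_powR // l0 ltW.
Qed.

End LogBase.

(** * Bounds on the number of tests *)

Section Bounds.
Context {R : realType} {D : nat} (Psi : 'I_D -> R[i]) (eps delta lam : R).
Hypotheses (D2 : (2 <= D)%N) (Psi1 : unit_vector Psi).
Hypotheses (eps01 : 0 < eps < 1) (delta01 : 0 < delta < 1) (lam01 : 0 < lam < 1).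
Let L := log_base lam delta.
Let le0 : 0 < lam * eps.
Proof. by case/andP: lam01 => ? _; case/andP: eps01 => ? _; rewrite mulr_gt0. Qed.

(** The bound on [N] makes the bracket multiplied by [1 - lam] in [Fval_ge] nonnegative, so
    [lam ^+ k <= delta] is enough. *)
Lemma Fval_ge_of_ceil (N k : nat) : L <= k%:R ->
  k%:R + k%:R * (1 - eps) / (lam * eps) <= N%:R ->
  1 - eps <= Fval N Psi delta lam.
Proof.
move=> Lk kN; case/andP: (eps01) => e0 e1; case/andP: (lam01) => l0 l1.
have k0 : 0 < k%:R :> R := lt_le_trans (log_base_gt0 _ _ delta01 lam01) Lk.
have x0 : 0 <= k%:R * (1 - eps) / (lam * eps).
  by rewrite divr_ge0 ?mulr_ge0 ?subr_ge0 // ltW.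
have kN' : (k <= N)%N by rewrite -(ler_nat R); lra.
apply: (Fval_ge _ _ _ _ D2 Psi1 delta01 lam01 N k) => //.
  by apply: leq_trans kN'; rewrite -(ltr_nat R).
have dk := exp_le_of_log _ _ delta01 lam01 _ Lk.
have h : 0 <= (N%:R - k%:R) * lam * eps - (1 - eps) * k%:R.
  have : k%:R * (1 - eps) / (lam * eps) <= N%:R - k%:R by lra.
  rewrite ler_pdivrMr // => h; lra.
rewrite exprSr; case/andP: (delta01) => d0 _.
apply: (@le_trans _ _ (delta * lam)); first by rewrite ler_pM2r.
by rewrite ler_pM2l // lerDr mulr_ge0 // subr_ge0 ltW.
Qed.

(** With t = L - k, the bound on [N] says that the bracket in [Fval_ge] is at least t, while
    [lam ^+ k.+1] is [delta] times lam^(1 - t), which [powR_le_chord] bounds by t + (1 - t) lam. *)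
Lemma Fval_ge_of_floor (N k : nat) : k%:R <= L <= k%:R + 1 ->
  L / (lam * eps) - (1 - lam) * k%:R / lam <= N%:R ->
  1 - eps <= Fval N Psi delta lam.
Proof.
move=> /andP[kL Lk] LN; case/andP: (eps01) => e0 e1; case/andP: (lam01) => l0 l1.
have L0 : 0 < L := log_base_gt0 _ _ delta01 lam01.
have h : L - (1 - lam) * k%:R * eps <= N%:R * (lam * eps).
  rewrite -ler_pdivrMr // (le_trans _ LN) // le_eqVlt; apply/orP; left; apply/eqP.
  by field; rewrite !gt_eqF.
have h' : L - k%:R <= (N%:R - k%:R) * lam * eps - (1 - eps) * k%:R by lra.
have kN : (k <= N)%N.
  rewrite -(ler_nat R) -subr_ge0 -(pmulr_lge0 _ le0).
  have : 0 <= (1 - eps) * k%:R by rewrite mulr_ge0 // subr_ge0 ltW.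
  lra.
have N0 : (0 < N)%N.
  case: (posnP N) h kN => // ->; rewrite leqn0 => h /eqP k0; move: h.
  by rewrite k0 mulr0 !mul0r subr0 leNgt L0.
apply: (Fval_ge _ _ _ _ D2 Psi1 delta01 lam01 N k) => //.
case/andP: (delta01) => d0 _.
have -> : lam ^+ k.+1 = delta * lam `^ (1 - (L - k%:R)).
  rewrite -[X in X * _](powR_log_base _ _ delta01 lam01) -/L -powRD; last first.
    by rewrite (gt_eqF l0) implybT.
  by rewrite -powR_mulrn ?(ltW l0) // -natr1; congr (_ `^ _); ring.
rewrite ler_pM2l //; apply: le_trans (powR_le_chord lam lam01 (L - k%:R) _) _.
  by apply/andP; split; lra.
have : (1 - lam) * (L - k%:R) <= (1 - lam) * ((N%:R - k%:R) * lam * eps - (1 - eps) * k%:R).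
  by rewrite ler_pM2l // subr_gt0.
lra.
Qed.

Lemma ceil_le_of_Fval_ge (N k : nat) : k%:R <= L -> 1 - eps <= Fval N Psi delta lam ->
  (k%:Z + Num.ceil (k%:R * (1 - eps) / (lam * eps)) <= N%:Z).
Proof.
(* For [k = 0] the bound is 0; otherwise a smaller [N] would contradict [Fval_lt]. *)
move=> kL; have [->|k0] := posnP k; first by rewrite !mul0r ceil0.
apply: contraTT; rewrite -!ltNge -ltrBlDl ceil_gt_int.
rewrite rmorphB /= -!pmulrn ltr_pdivlMr // => h.
apply: (Fval_lt _ _ _ _ D2 Psi1 eps01 delta01 lam01 N k) => //.
  exact: le_exp_of_log.
lra.
Qed.

End Bounds.

(** * The minimal number of tests *)

Theorem theorem3 (R : realType) (D : nat) (Psi : 'I_D -> R[i]) (eps delta lam : R) :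
  (2 <= D)%N -> unit_vector Psi ->
  0 < eps < 1 -> 0 < delta < 1 -> 0 < lam < 1 ->
  let F := 1 - eps in
  let nu := 1 - lam in
  let kp := Num.ceil (log_base lam delta) in
  let km := Num.floor (log_base lam delta) in
  exists n : nat,
    is_Nmin Psi eps delta lam n /\
    km + Num.ceil (km%:~R * F / (lam * eps)) <= n%:Z /\
    n%:Z <= kp + Num.ceil (kp%:~R * F / (lam * eps)) /\
    n%:Z <= Num.ceil (log_base lam delta / (lam * eps) - nu * km%:~R / lam) /\
    log_base lam delta / (lam * eps) - nu * km%:~R / lam
      = ln delta / (lam * eps * ln lam) - nu * km%:~R / lam /\
    (log_base lam delta \is a Num.int ->
       km + Num.ceil (km%:~R * F / (lam * eps)) = n%:Z /\
       n%:Z = kp + Num.ceil (kp%:~R * F / (lam * eps)) /\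
       n%:Z = Num.ceil (log_base lam delta / (lam * eps) - nu * km%:~R / lam)).
Proof.
move=> D2 Psi1 eps01 delta01 lam01 F nu kp km.
have L0 := log_base_gt0 _ _ delta01 lam01.
set L := log_base lam delta in L0 kp km *.
case/andP: (eps01) => e0 e1; case/andP: (lam01) => l0 l1.
have le0 : 0 < lam * eps by rewrite mulr_gt0.
pose B1 := kp + Num.ceil (kp%:~R * F / (lam * eps)).
pose B2 := Num.ceil (L / (lam * eps) - nu * km%:~R / lam).
have [b kpE] : exists b : nat, kp = b%:Z.
  by exists `|kp|%N; rewrite gez0_abs // ltW // ceil_gt0.
have [a kmE] : exists a : nat, km = a%:Z.
  by exists `|km|%N; rewrite gez0_abs // floor_ge0 ltW.
have Lb : L <= b%:R by have := ceil_ge L; rewrite -/kp kpE.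
have aL : a%:R <= L <= a%:R + 1.
  have := floor_itv L; rewrite -/km kmE intrD => /andP[-> /ltW].
  by rewrite -pmulrn.
pose good (N : nat) := (0 < N)%N && `[< 1 - eps <= Fval N Psi delta lam >].
have x0 : 0 <= b%:R * F / (lam * eps).
  by rewrite divr_ge0 ?mulr_ge0 ?subr_ge0 // ltW.
have B1_gt0 : 0 < B1.
  by rewrite ltr_pwDl ?ceil_gt0 // kpE -pmulrn ceil_ge0 (lt_le_trans _ x0) ?ltrN10.
have good_B1 : good `|B1|%N.
  rewrite /good absz_gt0 gt_eqF //=; apply/asboolP.
  apply: (Fval_ge_of_ceil _ _ _ _ D2 Psi1 eps01 delta01 lam01 _ b) => //.
  rewrite [leRHS]pmulrn gez0_abs ?(ltW B1_gt0) // /B1 intrD kpE -!pmulrn lerD2l.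
  exact: ceil_ge.
have B2_gt0 : 0 < B2.
  rewrite ceil_gt0 kmE -pmulrn -(pmulr_lgt0 _ le0).
  (* Both summands are nonnegative; the first is positive if [a = 0], the second otherwise. *)
  rewrite [ltRHS](_ : _ = (L - a%:R) + a%:R * (1 - nu * eps)); last first.
    by rewrite /nu; field; rewrite !gt_eqF.
  have nu_eps : nu * eps < 1.
    by rewrite mulr_ilt1 ?subr_ge0 ?(ltW l1) ?(ltW e0) // /nu gtrBl.
  case: (posnP a) => [->|a0]; first by rewrite mul0r addr0 subr0.
  by rewrite ltr_wpDl ?mulr_gt0 ?ltr0n ?subr_gt0 ?subr_ge0 //; case/andP: aL.
have good_B2 : good `|B2|%N.
  rewrite /good absz_gt0 gt_eqF //=; apply/asboolP.
  apply: (Fval_ge_of_floor _ _ _ _ D2 Psi1 eps01 delta01 lam01 _ a) => //.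
  rewrite [leRHS]pmulrn gez0_abs ?(ltW B2_gt0) // /B2 kmE -pmulrn.
  exact: ceil_ge.
have exN : exists N, good N by exists `|B1|%N.
(* The minimum exists because [B1] is good. Positivity of [B1] and [B2] lets these integers be
   compared with [n] through their absolute values. *)
have [n /andP[n0 /asboolP n_good] n_min] := ex_minnP exN.
have n_le (B : int) : 0 < B -> good `|B|%N -> n%:Z <= B.
  by move=> B0 /n_min; rewrite -lez_nat gez0_abs // ltW.
have lower : km + Num.ceil (km%:~R * F / (lam * eps)) <= n%:Z.
  rewrite kmE -pmulrn.
  by apply: (ceil_le_of_Fval_ge _ _ _ _ D2 Psi1 eps01 delta01 lam01 n a _ n_good); case/andP: aL.
have upper1 : n%:Z <= B1 by exact: n_le.
have upper2 : n%:Z <= B2 by exact: n_le.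
exists n; split; [split=> //; split=> // m m0 mn mgood|].
  by have := n_min m; rewrite /good m0 leqNgt mn => /(_ (asboolT mgood)).
do 3!split=> //; split.
  congr (_ - _); rewrite /L /log_base; field.
  by rewrite [ln lam == 0]lt_eqF ?ln_lt0 // !gt_eqF.
(* Floor and ceiling coincide with [L], so the lower bound meets [B1]; moving the integer [L] inside
   the ceiling turns [B1] into [B2]. *)
move=> L_int.
have kmL : km%:~R = L by apply: floorK.
have kpL : kp%:~R = L by apply: ceilK.
have kmp : km = kp by apply: (@intr_inj R); rewrite kmL kpL.
have nB1 : n%:Z = B1 by apply/eqP; rewrite eq_le upper1 /B1 -kmp lower.
split; first by rewrite nB1 kmp.
split=> //; rewrite nB1 /B1 -ceilDzr ?intr_int // kpL kmL; congr Num.ceil.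
by rewrite /F /nu; field; rewrite !gt_eqF.
Qed.
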